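(* For a Tychonoff space $X$, the following conditions are equivalent: (1) $X$ is pseudocompact; (2) $P_\sigma(X)$ is pseudocompact; (3) $P_\sigma(X)$ is $C^*$-embedded in $P(\beta X)$; (4) $P_\sigma(X)$ is compact and coincides with $P(\beta X)$.
   Context: $\beta X$ is the Stone–Čech compactification of $X$. $P(\beta X)$ is the set of Radon probability measures on the Borel $\sigma$-algebra of $\beta X$, with the weak topology, i.e. the topology generated by the functions $\mu\mapsto\int f\,d\mu$ for continuous $f:\beta X\to\mathbb R$. $P_\sigma(X)$ is the subspace of all $\mu\in P(\beta X)$ such that $\mu(K)=0$ for every compact set $K\subset\beta X\setminus X$ that is of type $G_\delta$ in $\beta X$. A space is pseudocompact if every continuous real-valued function on it is bounded. A subspace $Y\subset Z$ is $C^*$-embedded in $Z$ if every bounded continuous function $Y\to\mathbb R$ extends to a continuous function on $Z$. *)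

(* Defs.v *)
From HB Require Import structures.
From mathcomp Require Import all_boot all_order all_algebra.
From mathcomp Require Import all_classical all_reals all_analysis borel_hierarchy.

Set Implicit Arguments.
Unset Strict Implicit.
Unset Printing Implicit Defensive.

Import Order.TTheory GRing.Theory Num.Theory.
Import numFieldNormedType.Exports.

Local Open Scope classical_set_scope.
Local Open Scope ring_scope.

Definition tychonoff_space (X : topologicalType) : Prop :=
  hausdorff_space X /\ completely_regular_space X.

Definition pseudocompact_space (R : realType) (X : topologicalType) : Prop :=
  forall f : X -> R, continuous f -> [bounded f x | x in [set: X]].

Definition Cstar_embedded (R : realType) (Z : topologicalType) (Y : set Z) :
    Prop :=
  forall f : Y -> R, continuous f -> [bounded f y | y in [set: Y]] ->
  exists2 g : Z -> R, continuous g & forall y : Y, g (set_val y) = f y.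

Section StoneCech.
Variables (R : realType) (X : topologicalType).

Definition Cstar : set (X -> R) :=
  [set f | continuous f /\ [bounded f x | x in [set: X]]].

Definition Cstar_eval (x : X) : {ptws Cstar -> R} := fun f => set_val f x.

(* The Stone-Cech compactification is realized as the closure of the image of *)
(* X under the evaluation map into the product of copies of R indexed by all  *)
(* bounded continuous functions; the lemmas below are its characteristic      *)
(* properties.                                                                *)
Definition stone_cech : topologicalType := closure (range Cstar_eval).

Definition to_stone_cech (x : X) : stone_cech :=
  exist _ (Cstar_eval x) (mem_set (subset_closure (imageT Cstar_eval x))).

Lemma stone_cech_hausdorff : hausdorff_space stone_cech.
Proof.
have hP : hausdorff_space {ptws Cstar -> R}.
  by apply: (@hausdorff_product {classic Cstar} (fun=> R)) => _; exact: Rhausdorff.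
move=> p q pq; apply/val_inj/hP => A B nA nB.
have [z [Az Bz]] := pq (set_val @^-1` A) (set_val @^-1` B)
  (@initial_continuous _ _ set_val p _ nA) (@initial_continuous _ _ set_val q _ nB).
by exists (set_val z).
Qed.

Lemma stone_cech_compact : compact [set: stone_cech].
Proof.
have bdd (f : Cstar) : exists M : R, forall x, `|set_val f x| <= M.
  have [_ [M0 [_ fM]]] : Cstar (set_val f) by exact: set_valP.
  by exists (M0 + 1) => x; apply: fM => //; rewrite ltrDl.
pose M f := sval (cid (bdd f)).
have MP f x : `|set_val f x| <= M f by rewrite /M; case: cid => /= ? /(_ x).
pose B : set {ptws Cstar -> R} := [set g | forall f, `[- M f, M f]%classic (g f)].
have cB : compact B.
  apply: (@tychonoff {classic Cstar} (fun=> R) (fun f => `[- M f, M f]%classic)).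
  by move=> f; exact: segment_compact.
have clB : closed B.
  apply: compact_closed cB.
  by apply: (@hausdorff_product {classic Cstar} (fun=> R)) => _; exact: Rhausdorff.
have cC : compact (closure (range Cstar_eval)).
  apply: (subclosed_compact _ cB); first exact: closed_closure.
  rewrite [X in _ `<=` X]((closure_id B).1 clB); apply: closureS => _ [x _ <-] f.
  by rewrite /= in_itv /= -ler_norml; exact: MP.
move=> F FF _; have FG : (set_val @ F) (closure (range Cstar_eval)).
  by apply: (@filterS _ F _ setT); [move=> z _; exact: set_valP | exact: filterT].
have [p [Cp clp]] := cC (set_val @ F) _ FG.
exists (exist _ p (mem_set Cp)); split=> // A U FA [V [[W oW <-] Wp WU]].
have [_ [[z Az <-] Wz]] := clp (set_val @` A) W
  (filterS (@preimage_image _ _ set_val A) FA) (open_nbhs_nbhs (conj oW Wp)).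
by exists z; split=> //; exact: WU.
Qed.

Lemma dense_to_stone_cech : dense (range to_stone_cech).
Proof.
move=> O [p +] [W oW WE]; rewrite -WE => Wp.
have [_ [[x _ <-] Wx]] := set_valP p W (open_nbhs_nbhs (conj oW Wp)).
by exists (to_stone_cech x); split=> //; exact: imageT.
Qed.

Lemma stone_cech_extension (f : X -> R) :
  continuous f -> [bounded f x | x in [set: X]] ->
  exists2 g : stone_cech -> R, continuous g & forall x, g (to_stone_cech x) = f x.
Proof.
move=> cf bf; have Cf : Cstar f by [].
pose i : Cstar := exist _ f (mem_set Cf).
exists (fun p => (set_val p : {ptws Cstar -> R}) i) => // p.
apply: (@continuous_comp stone_cech {ptws Cstar -> R} R set_val (fun g => g i)).
  exact: initial_continuous.
exact: (@proj_continuous {classic Cstar} (fun=> R)).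
Qed.

Lemma to_stone_cech_embedding : tychonoff_space X ->
  injective to_stone_cech /\ @open X = @open (initial_topology to_stone_cech).
Proof.
move=> [hX crX].
pose ev (i : {classic Cstar}) : X -> R := set_val (i : Cstar).
have cev i : continuous (ev i).
  by have [] : Cstar (ev i) by exact: set_valP.
have sep : separate_points_from_closed ev.
  move=> U x clU nUx.
  have [f [cf f01 fx fU]] := (@uniform_separatorP _ R _ _).1 (crX _ _ clU nUx).
  have Cf : Cstar f.
    split=> //; exists 1; split=> // M M1 y _ /=.
    have /f01 : range f (f y) by exact: imageT.
    rewrite /= in_itv /= => /andP[f0 f1].
    by rewrite ger0_norm// (le_trans f1)// ltW.
  exists (exist _ f (mem_set Cf)); rewrite /ev /= => clf.
  have : closure [set 1 : R] (f x) by exact: closureS fU _ clf.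
  rewrite -(closure_id _).1; last first.
    exact/accessible_closed_set1/hausdorff_accessible/Rhausdorff.
  by rewrite (fx (f x) (imageP _ _))//= => /esym/eqP; rewrite oner_eq0.
have inj := join_product_inj sep (hausdorff_accessible hX).
have opE := join_product_initial sep cev inj.
have evE : join_product ev = Cstar_eval by [].
split=> [x y /(congr1 set_val) xy|]; first by apply: inj xy; rewrite inE.
rewrite opE evE; apply/seteqP; split=> A /=.
  by move=> [W oW <-]; exists (set_val @^-1` W) => //; exists W.
by move=> [_ [W oW <-] <-]; exists W.
Qed.

End StoneCech.

(* Measurable types are pointed in the library, so the Borel sigma-algebra is *)
(* relative to a (proof-irrelevant) witness that T is nonempty.               *)
Definition pointed_at (T : Type) (T_neq0 : $|T|) : Type := T.
HB.instance Definition _ (T : choiceType) (h : $|T|) :=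
  Choice.on (pointed_at h).
HB.instance Definition _ (T : choiceType) (h : $|T|) :=
  isPointed.Build (pointed_at h) (unsquash h).

Definition borel (T : topologicalType) (T_neq0 : $|T|) :=
  g_sigma_algebraType (@open T : set (set (pointed_at T_neq0))).
HB.instance Definition _ (T : topologicalType) (h : $|T|) :=
  Measurable.on (borel h).

(* The last field fixes the irrelevant values of the library's measures       *)
(* outside the sigma-algebra, so that equality of elements is equality of     *)
(* measures on Borel sets.                                                    *)
Record radon_probability (R : realType) (T : topologicalType) := RadonProbability {
  radon_neq0 : $|T| ;
  radon_measure :> probability (borel radon_neq0) R ;
  radon_inner_regular : forall A : set T,
    measurable (A : set (borel radon_neq0)) -> forall e : R, 0 < e ->
    exists K : set T,
      [/\ compact K, K `<=` A & (radon_measure (A `\` K) < e%:E)%E] ;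
  radon_non_borel : forall A : set T,
    ~ measurable (A : set (borel radon_neq0)) -> radon_measure A = 0%E
}.

Lemma radon_probability_ext (R : realType) (T : topologicalType)
    (mu nu : radon_probability R T) :
  (forall A : set T, <<s open >> A -> mu A = nu A) -> mu = nu.
Proof.
case: mu nu => [h mu rmu nmu] [h' nu rnu nnu] /= eq_mn.
move: nu rnu nnu eq_mn; rewrite (Prop_irrelevance h' h) => nu rnu nnu eq_mn.
have mn : mu = nu :> (set T -> \bar R).
  apply/funext => A; have [mA|nA] := pselect (measurable (A : set (borel h))).
    exact: eq_mn.
  by rewrite nmu// nnu.
have {}mn : mu = nu.
  case: mu mn {rmu nmu eq_mn}.
  move=> mu [[m1 m2] [m3] [m4] [m5] [m6] [m7] [m8]] /= mn; subst mu.
  case: nu {rnu nnu} m1 m2 m3 m4 m5 m6 m7 m8.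
  move=> nu [[n1 n2] [n3] [n4] [n5] [n6] [n7] [n8]] /= m1 m2 m3 m4 m5 m6 m7 m8.
  rewrite (Prop_irrelevance m1 n1) (Prop_irrelevance m2 n2).
  rewrite (Prop_irrelevance m3 n3) (Prop_irrelevance m4 n4).
  rewrite (Prop_irrelevance m5 n5) (Prop_irrelevance m6 n6).
  by rewrite (Prop_irrelevance m7 n7) (Prop_irrelevance m8 n8).
move: rnu nnu; rewrite -mn => rnu nnu.
by rewrite (Prop_irrelevance rnu rmu) (Prop_irrelevance nnu nmu).
Qed.

Section BorelRestriction.
Variables (R : realType) (T : topologicalType) (h : $|T|).
Variable mu : probability (borel h) R.

Definition borel_restriction (A : set (borel h)) : \bar R :=
  if `[< measurable A >] then mu A else 0%E.

Lemma borel_restrictionE A : measurable A -> borel_restriction A = mu A.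
Proof. by rewrite /borel_restriction => /asboolP ->. Qed.

Let restr0 : borel_restriction set0 = 0%E.
Proof. by rewrite borel_restrictionE. Qed.

Let restr_ge0 A : (0 <= borel_restriction A)%E.
Proof. by rewrite /borel_restriction; case: ifP. Qed.

Let restr_sigma_additive : semi_sigma_additive borel_restriction.
Proof.
move=> F mF tF mUF; rewrite borel_restrictionE//.
under eq_fun do under eq_bigr do rewrite borel_restrictionE//.
exact: measure_semi_sigma_additive.
Qed.

HB.instance Definition _ := isMeasure.Build _ _ _ borel_restriction
  restr0 restr_ge0 restr_sigma_additive.

Let restrT : borel_restriction setT = 1%E.
Proof. by rewrite borel_restrictionE// probability_setT. Qed.

HB.instance Definition _ :=
  Measure_isProbability.Build _ _ _ borel_restriction restrT.

Lemma radon_probability_exists :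
  (forall A : set T, <<s open >> A -> forall e : R, 0 < e ->
    exists K : set T,
      [/\ compact K, <<s open >> K, K `<=` A & (mu (A `\` K) < e%:E)%E]) ->
  exists nu : radon_probability R T,
    forall A : set T, <<s open >> A -> nu A = mu A.
Proof.
move=> mu_reg.
have reg (A : set T) : measurable (A : set (borel h)) -> forall e : R, 0 < e ->
    exists K : set T,
      [/\ compact K, K `<=` A & (borel_restriction (A `\` K) < e%:E)%E].
  move=> mA e e0; have [K [cK mK KA KAe]] := mu_reg A mA e e0.
  exists K; split=> //; rewrite borel_restrictionE//.
  exact: (@measurableD _ (borel h)).
have off (A : set T) : ~ measurable (A : set (borel h)) ->
    borel_restriction A = 0%E.
  by rewrite /borel_restriction => /asboolPn/negbTE ->.
exists (@RadonProbability R T h borel_restriction reg off) => A mA /=.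
exact: borel_restrictionE.
Qed.

End BorelRestriction.

Section WeakTopology.
Variables (R : realType) (T : topologicalType).
Let P := radon_probability R T.

HB.instance Definition _ := gen_eqMixin (radon_probability R T).
HB.instance Definition _ := gen_choiceMixin (radon_probability R T).

HB.instance Definition _ := Topological.copy (radon_probability R T)
  (sup_topology (fun f : continuousType T R => Topological.class
    (initial_topology (fun mu : P => \int[mu]_x f x)))).

End WeakTopology.

Definition P_sigma (R : realType) (X : topologicalType) :
    set (radon_probability R (stone_cech R X)) :=
  [set mu | forall K : set (stone_cech R X),
    compact K -> K `<=` ~` range (@to_stone_cech R X) -> Gdelta K ->
    mu K = 0%E].
Arguments P_sigma : clear implicits.

(* Main.v *)
From HB Require Import structures.
Require Import Defs.
From mathcomp Require Import all_boot all_order all_algebra.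
From mathcomp Require Import all_classical all_reals all_analysis borel_hierarchy.
From mathcomp Require Import measurable_realfun ring lra.
Local Open Scope classical_set_scope.

(* If f is an unbounded continuous function on X, then 1/(1+|f|) extends to a *)
(* continuous g >= 0 on bX that is positive on X and vanishes at some p. The  *)
(* function F(nu) = \int g dnu is then positive on P_sigma(X) and takes       *)
(* arbitrarily small values at the point masses of X. Hence 1/F is unbounded  *)
(* on P_sigma(X), so (2) implies (1). The bounded function cos(1/F) has no    *)
(* continuous extension to P(bX): for q in X and s > 0 its value at           *)
(* (1-s) delta_p + s delta_q would be cos(1/(s g(q))), by density of X in bX, *)
(* and this has no limit as s tends to 0; so (3) implies (1). Conversely, if  *)
(* X is pseudocompact, a nonempty compact G_delta set of bX meets X, so       *)
(* P_sigma(X) is all of P(bX), and it remains to see that P(bX) is compact.   *)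
(* Given an ultrafilter on P(bX), the limits lambda(C) of the masses of the   *)
(* closed sets C form a content, which is regularized to a Radon measure nu   *)
(* by nu(U) = sup {lambda(C) | C closed, C included in U} for U open; the     *)
(* ultrafilter converges to nu.                                               *)

Set Implicit Arguments.
Unset Strict Implicit.
Unset Printing Implicit Defensive.
Import Order.TTheory GRing.Theory Num.Theory.
Import numFieldNormedType.Exports.
Local Open Scope ring_scope.

(** * The weak topology on Radon probabilities *)

(** Everything passes through condition (1). [pseudocompact_P_sigma] and [Cstar_embedded_P_sigma]
    derive it from (2) and (3); both exploit a function g on bX that is positive on X but not
    bounded away from 0 there, supplied by [not_pseudocompact_zero]. Such a g has positive integral
    against every element of P_sigma(X), because its zero set is one of the sets that these measures
    ignore. From (1), [pseudocompact_Gdelta] leaves no nonempty set to ignore, and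
    [radon_probability_compact] gives compactness. For the latter, the limit masses along an
    ultrafilter need not be countably additive, so [radon_of_content] regularizes them; the
    resulting measure is dominated by the limit masses on open sets, and this one-sided bound,
    applied to f and to -f, identifies the limits of all integrals. Once P_sigma(X) is all of P(bX),
    (2) and (3) are formal. *)

Section WeakTopologyLemmas.
Context {R : realType} {T : topologicalType}.
Implicit Types mu nu : radon_probability R T.

Lemma continuous_Rintegral (f : T -> R) : continuous f ->
  continuous (fun nu : radon_probability R T => \int[nu]_x f x).
Proof.
move=> cf mu; pose g : continuousType T R := mkcts cf.
have /cvg_sup/(_ g) nmu : nbhs mu --> mu by apply: cvg_id.
have ci := @initial_continuous (radon_probability R T) R
  (fun nu => \int[nu]_x g x) mu.
move=> A /ci; exact: nmu.
Qed.

Lemma cvg_radon (F : set_system (radon_probability R T)) mu : Filter F ->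
  (forall f : T -> R, continuous f ->
    (fun nu : radon_probability R T => \int[nu]_x f x) @ F --> \int[mu]_x f x) ->
  F --> mu.
Proof.
move=> FF Fmu; apply/cvg_sup => f A.
rewrite (@nbhsE (initial_topology
  (fun nu : radon_probability R T => \int[nu]_x f x))) => -[B [[V oV <-] Vmu] BA].
have cf : continuous f by exact: cts_fun.
exact: filterS BA (Fmu _ cf _ (open_nbhs_nbhs (conj oV Vmu))).
Qed.

Lemma measurable_borel_continuous (h : $|T|) (f : T -> R) : continuous f ->
  measurable_fun [set: borel h] (f : borel h -> R).
Proof.
move=> /continuousP cf.
apply: (measurability _ (measurable_realfun.RGenOpens.measurableE R)).
move=> _ [_ [a [b ->] <-]]; rewrite setTI; apply: sub_sigma_algebra.
exact/cf/interval_open.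
Qed.
End WeakTopologyLemmas.

(** * Integrals against a probability measure *)

(** A counts the integers among 1, ..., n that lie strictly below y, so it trails y by at most 1
    until the cap n is reached. *)
Lemma layer_count_bounds {R : realType} (y : R) n : 0 <= y ->
  let A := \sum_(k < n) ((k.+1%:R < y)%R : nat)%:R : R in
  [/\ A <= y & y <= n%:R -> y <= A + 1].
Proof.
move=> y0 /=.
(* The induction needs the wider range y <= n + 1 and the exact value of A once all n integers are
   counted. *)
suff [] : let A := \sum_(k < n) ((k.+1%:R < y)%R : nat)%:R : R in
  [/\ A <= y, y <= n.+1%:R -> y <= A + 1 & n%:R < y -> A = n%:R].
  by move=> ? h _; split=> // yn; apply: h; rewrite (le_trans yn)// ler_nat.
elim: n => [|n [Ay yA An]] /=; first by rewrite big_ord0 add0r.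
rewrite big_ord_recr/=; case: ltP => yn; last first.
  by rewrite mulr0n addr0; split=> // _; exact: yA.
have An' : \sum_(k < n) ((k.+1%:R < y)%R : nat)%:R = n%:R :> R.
  by apply: An; rewrite (lt_trans _ yn)// ltr_nat.
by rewrite An' -natrD addn1; split=> //; [exact: ltW|rewrite -natr1].
Qed.

Section ProbabilityIntegral.
Context {d} {T : measurableType d} {R : realType} (mu : probability T R).

Let muT : (mu : {measure set T -> \bar R}) setT = 1%E.
Proof. exact: probability_setT. Qed.

Lemma bounded_integrable (f : T -> R) (M : R) : measurable_fun setT f ->
  (forall x, `|f x| <= M) -> mu.-integrable setT (EFin \o f).
Proof.
move=> mf fM; apply: measurable_bounded_integrable => //.
  by rewrite muT ltry.
by exists M; split; rewrite ?num_real// => N MN x _; apply: le_trans (fM x) (ltW MN).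
Qed.

Lemma Rintegral_probability_cst (c : R) : \int[mu]_(x in setT) c = c.
Proof. by rewrite Rintegral_cst// muT mulr1. Qed.

Lemma Rintegral_bounded (f : T -> R) (M : R) : measurable_fun setT f ->
  (forall x, `|f x| <= M) -> `|\int[mu]_x f x| <= M.
Proof.
move=> mf fM; have intf := bounded_integrable mf fM.
have cstE := Rintegral_probability_cst.
have cstI (c : R) : mu.-integrable setT (EFin \o cst c).
  exact: (@bounded_integrable _ `|c|).
rewrite ler_norml -{1}[M](cstE M) -[M in (_ <= _ <= M)](cstE M).
have -> : - (\int[mu]_(x in setT) M) = \int[mu]_(x in setT) (- M) by rewrite !cstE.
apply/andP; split.
  apply: le_Rintegral => //; first exact: (cstI (- M)).
  by move=> x _; have := fM x; rewrite ler_norml => /andP[].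
apply: le_Rintegral => //; first exact: (cstI M).
by move=> x _; have := fM x; rewrite ler_norml => /andP[].
Qed.

Lemma Rintegral_gt0 (f : T -> R) (M : R) : measurable_fun setT f ->
  (forall x, 0 <= f x <= M) -> (mu (f @^-1` [set 0%R]) = 0)%E ->
  0 < \int[mu]_x f x.
Proof.
move=> mf f0 mu0.
have fM x : `|f x| <= M by have /andP[f0x fMx] := f0 x; rewrite ger0_norm.
have intf := bounded_integrable mf fM.
rewrite lt0r Rintegral_ge0 ?andbT; last by move=> x _; have /andP[] := f0 x.
apply/eqP => if0.
have : (\int[mu]_x `|(EFin \o f) x| = 0)%E.
  under eq_integral => x _ do rewrite /= ger0_norm ?(andP (f0 x)).1//.
  rewrite -[LHS]fineK; last exact: integrable_fin_num.
  by move: if0; rewrite /Rintegral => ->.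
move/ae_eq_integral_abs => /(_ measurableT (measurable_int mu intf)).
case=> N [mN muN0 fN].
have mf0 : measurable (f @^-1` [set 0%R]) by rewrite -[X in measurable X]setTI; exact: mf.
(* A zero integral makes f vanish off the null set N; the zero set of f is null as well, yet the two
   cover the space, whose mass is 1. *)
have : (mu [set: T] <= mu (f @^-1` [set 0%R]) + mu N)%E.
  apply: le_trans (measureU2 _ mf0 mN); apply: le_measure; rewrite ?inE//.
    exact: measurableU.
  move=> x _; have [fx|fx] := pselect (f x = 0); [by left|right].
  by apply: fN => /= /(_ Logic.I) [].
by rewrite muT mu0 muN0 adde0 lee_fin ler10.
Qed.

(** Layer-cake sums: S is the integral of the step function [s], which lies below f by at most
    1/(n+1). The superlevel sets are strict, hence open when f is continuous. *)
Lemma Rintegral_layer (f : T -> R) n : measurable_fun setT f ->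
  (forall x, 0 <= f x <= 1) ->
  let S := n.+1%:R^-1 *
    \sum_(k < n.+1) fine (mu [set x | k.+1%:R / n.+1%:R < f x]) in
  S <= \int[mu]_x f x <= S + n.+1%:R^-1.
Proof.
move=> mf f01 /=.
pose U (k : nat) : set T := [set x | k.+1%:R / n.+1%:R < f x].
have mU k : measurable (U k).
  have -> : U k = setT `&` f @^-1` `]k.+1%:R / n.+1%:R, +oo[.
    by rewrite setTI; apply/seteqP; split=> x /=; rewrite in_itv/= andbT.
  exact: mf.
pose s x : R := n.+1%:R^-1 * \sum_(k < n.+1) \1_(U k) x.
have n0 : 0 < n.+1%:R :> R by rewrite ltr0n.
have sE x : s x = n.+1%:R^-1 * \sum_(k < n.+1) ((k.+1%:R < n.+1%:R * f x)%R : nat)%:R.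
  congr (_ * _); apply: eq_bigr => k _; rewrite indicE; congr (_%:R); congr nat_of_bool.
  by apply/idP/idP; rewrite inE /U/= ltr_pdivrMr// mulrC.
have sf x : s x <= f x <= s x + n.+1%:R^-1.
  have /andP[fx0 fx1] := f01 x.
  have y0 : 0 <= n.+1%:R * f x by rewrite mulr_ge0// ltW.
  have [h1 h2] := layer_count_bounds n.+1 y0.
  rewrite sE -[X in _ + X]mulr1 -mulrDr !(ler_pdivrMl, ler_pdivlMl)// h1 h2//.
  by rewrite ler_piMr// ltW.
have ms : measurable_fun setT s.
  apply: measurable_funM => //; apply: measurable_sum => k; exact: measurable_indic.
have sM x : `|s x| <= 1.
  have /andP[fx0 fx1] := f01 x; have /andP[h1 h2] := sf x.
  rewrite ger0_norm ?(le_trans h1)// /s mulr_ge0 ?invr_ge0 ?(ltW n0)//.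
  apply: sumr_ge0 => k _.
  by rewrite indicE; case: (_ \in _).
have is' := bounded_integrable ms sM.
have ifM : mu.-integrable setT (EFin \o f).
  apply: (@bounded_integrable _ 1) => // x.
  by have /andP[h1 h2] := f01 x; rewrite ger0_norm.
have ic : mu.-integrable setT (EFin \o (cst n.+1%:R^-1 : T -> R)).
  exact: (@bounded_integrable _ `|n.+1%:R^-1|).
have -> : n.+1%:R^-1 * (\sum_(k < n.+1) fine (mu (U k))) = \int[mu]_x s x.
  rewrite RintegralZl//; last first.
    apply: (@bounded_integrable _ n.+1%:R).
      by apply: measurable_sum => k; exact: measurable_indic.
    move=> x; have := sM x; rewrite /s normrM ger0_norm ?invr_ge0 ?(ltW n0)//.
    by rewrite ler_pdivrMl// mulr1.
  congr (_ * _); rewrite /Rintegral.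
  under eq_integral do rewrite -sumEFin.
  rewrite ge0_integral_sum//; last first.
    by move=> k; apply/measurable_EFinP; exact: measurable_indic.
  under [in RHS]eq_bigr do rewrite integral_indic// setIT.
  by rewrite -sum_fine// => k _; exact: fin_num_measure.
apply/andP; split; first by apply: le_Rintegral => // x _; have /andP[] := sf x.
have -> : n.+1%:R^-1 = \int[mu]_(x in setT) (n.+1%:R^-1) :> R.
  by rewrite Rintegral_cst// muT mulr1.
rewrite -RintegralD//; apply: le_Rintegral => //.
  exact: (integrableD measurableT is' ic).
by move=> x _; have /andP[] := sf x.
Qed.
End ProbabilityIntegral.

(** * Two-point measures *)

Section DiracCombination.
Context {d} {T : measurableType d} {R : realType}.
Variables (y q : T) (s : R) (s01 : 0 <= s <= 1).

Let s_ge0 : 0 <= s. Proof. by have /andP[] := s01. Qed.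
Let s1_ge0 : 0 <= 1 - s. Proof. by have /andP[_] := s01; rewrite subr_ge0. Qed.

Definition dirac_combination : set T -> \bar R :=
  measure_add (mscale (NngNum s1_ge0) \d_y) (mscale (NngNum s_ge0) \d_q).

HB.instance Definition _ := Measure.on dirac_combination.

Lemma dirac_combinationE A :
  dirac_combination A = ((1 - s)%:E * \d_y A + s%:E * \d_q A)%E.
Proof. by rewrite /dirac_combination measure_addE. Qed.

Let dirac_combinationT : dirac_combination setT = 1%E.
Proof. by rewrite dirac_combinationE !diracT !mule1 -EFinD subrK. Qed.

HB.instance Definition _ :=
  Measure_isProbability.Build _ _ _ dirac_combination dirac_combinationT.

Lemma Rintegral_dirac_combination (f : T -> R) (M : R) :
  measurable_fun setT f -> (forall x, `|f x| <= M) ->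
  \int[dirac_combination]_x f x = (1 - s) * f y + s * f q.
Proof.
(* The integral splits over a sum of measures for nonnegative integrands; the shift by M reaches
   that case and is cancelled at the end. *)
move=> mf fM; pose g x := f x + M.
have g0 x : 0 <= g x.
  by have := fM x; rewrite ler_norml => /andP[]; rewrite /g -lerBlDr sub0r.
have mg : measurable_fun setT g by exact: measurable_funD.
have int_f := bounded_integrable dirac_combination mf fM.
have int_M : dirac_combination.-integrable setT (EFin \o (cst M : T -> R)).
  exact: (@bounded_integrable _ _ _ _ _ `|M|).
have gE : \int[dirac_combination]_x g x = (1 - s) * g y + s * g q.
  rewrite /Rintegral ge0_integral_measure_add//; last 2 first.
  - by move=> x _; rewrite lee_fin.
  - exact/measurable_EFinP.
  rewrite !ge0_integral_mscale//; first last.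
  - by move=> x _; rewrite lee_fin.
  - exact/measurable_EFinP.
  - by move=> x _; rewrite lee_fin.
  - exact/measurable_EFinP.
  by rewrite !integral_dirac//; do 2 ?exact/measurable_EFinP; rewrite !diracT !mul1e.
have ME : \int[dirac_combination]_(x in setT) M = M.
  exact: Rintegral_probability_cst.
apply: (addIr M); rewrite -[X in _ + X = _]ME -RintegralD// gE /g.
by rewrite !mulrDr addrACA -mulrDl subrK mul1r.
Qed.
End DiracCombination.

(** The two measures may carry different witnesses of nonemptiness, hence different Borel types;
    proof irrelevance identifies them before the integrals are compared. *)
Lemma radon_RintegralE {R : realType} {T : topologicalType} (h : $|T|)
    (m : probability (borel h) R) (nu : radon_probability R T) (f : T -> R) :
  (forall A : set T, <<s open >> A -> nu A = m A) ->
  \int[nu]_x f x = \int[m]_(x in [set: borel h]) f x.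
Proof.
case: nu => h' nu reg nb /=; move: nu reg nb.
rewrite (Prop_irrelevance h' h) => nu _ _ numE.
rewrite /Rintegral; congr fine; apply: eq_measure_integral => A mA _.
exact: numE.
Qed.

Lemma radon_convex_dirac_exists {R : realType} {T : topologicalType}
    (y q : T) (s : R) : hausdorff_space T -> 0 <= s <= 1 ->
  exists nu : radon_probability R T,
    (forall A : set T, <<s open >> A ->
      nu A = ((1 - s)%:E * (\1_A y)%:E + s%:E * (\1_A q)%:E)%E) /\
    (forall f : T -> R, continuous f -> forall M : R, (forall x, `|f x| <= M) ->
      \int[nu]_x f x = (1 - s) * f y + s * f q).
Proof.
move=> hT s01; pose h : $|T| := squash y.
pose mix : probability (borel h) R := @dirac_combination _ (borel h) R y q s s01.
have mixE A : mix A = ((1 - s)%:E * (\1_A y)%:E + s%:E * (\1_A q)%:E)%E.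
  exact: dirac_combinationE.
have [|nu nuE] := @radon_probability_exists R T h mix; last first.
  exists nu; split=> [A mA|f cf M fM].
    by rewrite nuE// mixE.
  have mf := measurable_borel_continuous (h := h) cf.
  rewrite -(Rintegral_dirac_combination (T := borel h) y q s01 mf fM).
  exact: radon_RintegralE.
move=> A mA e e0.
have cl1 (z : T) : closed [set z] by exact/accessible_closed_set1/hausdorff_accessible.
pose B := [set y] `|` [set q].
have cB : closed B by exact: closedU.
have mB : <<s open >> B.
  rewrite -[B]setCK; apply: (@measurableC _ (borel h)); apply: sub_sigma_algebra.
  exact: closed_openC.
(* All the mass sits on the two points of B, so this finite set leaves a null remainder. *)
exists (A `&` B); split.
- apply: finite_compact; apply: finite_setIr.
  by rewrite finite_setU; split; exact: finite_set1.
- exact: (@measurableI _ (borel h)).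
- exact: subIsetl.
- rewrite mixE !indicE !memNset ?mule0 ?adde0//.
  + by move=> -[Aq]; apply; split=> //; right.
  + by move=> -[Aq]; apply; split=> //; left.
Qed.

Lemma compact_borel (T : topologicalType) (K : set T) :
  hausdorff_space T -> compact K -> <<s open >> K.
Proof.
move=> hT /(compact_closed hT) cK; rewrite -[K]setCK -setTD.
have [_ + _] := @smallest_sigma_algebra T setT open; apply.
by apply: sub_sigma_algebra; exact: closed_openC.
Qed.

Section RadonCompact.
Context {R : realType} {T : topologicalType}.
Hypothesis cT : compact [set: T].

Lemma compact_continuous_bounded (f : T -> R) : continuous f ->
  exists M : R, forall x, `|f x| <= M.
Proof.
move=> cf; have /compact_bounded[M [_ fM]] : compact (f @` setT).
  by apply: continuous_compact => //; exact: continuous_subspaceT.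
by exists (M + 1) => x; apply: fM; [rewrite ltrDl|exists x].
Qed.

Lemma radon_Rintegral_gt0 (nu : radon_probability R T) (f : T -> R) :
  continuous f -> (forall x, 0 <= f x) -> (nu (f @^-1` [set 0%R]) = 0)%E ->
  0 < \int[nu]_x f x.
Proof.
move=> cf f0; have [M fM] := compact_continuous_bounded cf.
apply: (@Rintegral_gt0 _ _ _ _ _ M); first exact: measurable_borel_continuous.
by move=> x; rewrite f0 (le_trans (ler_norm _)).
Qed.

Lemma radon_integrable (nu : radon_probability R T) (f : T -> R) :
  continuous f -> (radon_measure nu).-integrable setT (EFin \o f).
Proof.
move=> cf; have [M fM] := compact_continuous_bounded cf.
exact: bounded_integrable (measurable_borel_continuous cf) fM.
Qed.
End RadonCompact.

Section DiracMix.
Context {R : realType} {T : topologicalType}.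
Hypotheses (cT : compact [set: T]) (hT : hausdorff_space T).

Lemma dirac_mix_exists (s : R) (s01 : 0 <= s <= 1) (y q : T) :
  exists nu : radon_probability R T,
    (forall A : set T, <<s open >> A ->
      nu A = ((1 - s)%:E * (\1_A y)%:E + s%:E * (\1_A q)%:E)%E) /\
    (forall f : T -> R, continuous f ->
      \int[nu]_x f x = (1 - s) * f y + s * f q).
Proof.
have [nu [nuE nuI]] := radon_convex_dirac_exists y q hT s01.
exists nu; split=> // f cf; have [M fM] := compact_continuous_bounded cT cf.
exact: nuI fM.
Qed.

(** The measure (1-s) delta_y + s delta_q; s is the weight of the second point, so s = 0 gives the
    point mass at y. *)
Definition dirac_mix (s : R) (s01 : 0 <= s <= 1) (y q : T) :
    radon_probability R T :=
  sval (cid (dirac_mix_exists s01 y q)).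

Lemma dirac_mixE s (s01 : 0 <= s <= 1) y q (A : set T) : <<s open >> A ->
  dirac_mix s01 y q A = ((1 - s)%:E * (\1_A y)%:E + s%:E * (\1_A q)%:E)%E.
Proof. exact: (svalP (cid (dirac_mix_exists s01 y q))).1. Qed.

Lemma Rintegral_dirac_mix s (s01 : 0 <= s <= 1) y q (f : T -> R) :
  continuous f ->
  \int[dirac_mix s01 y q]_x f x = (1 - s) * f y + s * f q.
Proof. exact: (svalP (cid (dirac_mix_exists s01 y q))).2. Qed.

Lemma dirac_mix_continuous_left s (s01 : 0 <= s <= 1) q :
  continuous (fun y => dirac_mix s01 y q).
Proof.
move=> y; apply: cvg_radon => f cf.
rewrite Rintegral_dirac_mix//.
have IE : (fun z => \int[dirac_mix s01 z q]_x f x) =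
    (fun z => (1 - s) * f z + s * f q).
  by apply/funext => z; rewrite Rintegral_dirac_mix.
change ((fun z => \int[dirac_mix s01 z q]_x f x) @ y --> (1 - s) * f y + s * f q).
rewrite IE; apply: cvgD; last exact: cvg_cst.
by apply: cvgM; [exact: cvg_cst|exact: cf].
Qed.

Lemma cvg_dirac_mix (F : set_system nat) (s : R^nat) (s01 : forall n, 0 <= s n <= 1)
   (z01 : 0 <= (0 : R) <= 1) y q : Filter F ->
  s @ F --> 0 -> (fun n => dirac_mix (s01 n) y q) @ F --> dirac_mix z01 y q.
Proof.
move=> FF s0; apply: cvg_radon => f cf.
rewrite Rintegral_dirac_mix//.
have IE : (fun n => \int[dirac_mix (s01 n) y q]_x f x) =
    (fun n => (1 - s n) * f y + s n * f q).
  by apply/funext => n; rewrite Rintegral_dirac_mix.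
change ((fun n => \int[dirac_mix (s01 n) y q]_x f x) @ F -->
  (1 - 0) * f y + 0 * f q).
rewrite IE; apply: cvgD; apply: cvgMl => //.
by apply: cvgB => //; exact: cvg_cst.
Qed.
End DiracMix.

(** * Functions on the Stone-Cech compactification *)

Lemma continuous_normr {R : realType} {T : topologicalType} (f : T -> R) :
  continuous f -> continuous (fun x => `|f x|).
Proof.
move=> cf x; apply: (@continuous_comp _ _ _ f (fun r : R => `|r|)).
  exact: cf.
exact: (@norm_continuous R R^o).
Qed.

Lemma continuous_invr {R : realType} {T : topologicalType} (f : T -> R) :
  (forall x, f x != 0) -> continuous f -> continuous (fun x => (f x)^-1).
Proof. by move=> f0 cf x; apply: cvgV => //; exact: cf. Qed.

Lemma dense_lt {R : realType} {T : topologicalType} (D : set T) (g : T -> R)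
    (p : T) (e : R) :
  dense D -> continuous g -> g p < e -> exists2 x, D x & g x < e.
Proof.
move=> dD /continuousP cg gpe.
have [||x [gx Dx]] := dD (g @^-1` [set r | r < e]); [by exists p| |by exists x].
by apply: cg; exact: open_lt.
Qed.

Lemma dense_eq {R : realType} {T : topologicalType} (D : set T) (f g : T -> R) :
  dense D -> continuous f -> continuous g -> (forall x, D x -> f x = g x) -> f = g.
Proof.
move=> dD cf cg fg; apply/funext => p; apply/eqP; rewrite -subr_eq0 -normr_le0.
rewrite leNgt; apply/negP => fgp.
have cn : continuous (fun z => `|f z - g z|).
  by apply: continuous_normr => z; apply: cvgB; [exact: cf|exact: cg].
have ch : continuous (fun z => - `|f z - g z|) by move=> z; apply: cvgN; exact: cn.
have [|x Dx] := @dense_lt _ _ _ _ p 0 dD ch; first by rewrite oppr_lt0.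
by rewrite fg// subrr normr0 oppr0 ltxx.
Qed.

Section StoneCechFacts.
Context {R : realType} {X : topologicalType}.
Local Notation bX := (stone_cech R X).
Local Notation iX := (@to_stone_cech R X).

Lemma to_stone_cech_continuous : tychonoff_space X -> continuous iX.
Proof.
move=> tX; have [_ opE] := to_stone_cech_embedding R tX.
by apply/continuousP => A oA; rewrite opE; exists A.
Qed.

Lemma stone_cech_lt (g : bX -> R) (p : bX) (e : R) : continuous g -> g p < e ->
  exists x, g (iX x) < e.
Proof.
move=> cg gpe; have [_ [x _ <-] gx] := dense_lt (@dense_to_stone_cech R X) cg gpe.
by exists x.
Qed.

Lemma stone_cech_eq (f g : bX -> R) : continuous f -> continuous g ->
  (forall x, f (iX x) = g (iX x)) -> f = g.
Proof.
move=> cf cg fg; apply: (dense_eq (@dense_to_stone_cech R X)) => // _ [x _ <-].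
exact: fg.
Qed.

Lemma not_pseudocompact_zero : ~ pseudocompact_space R X ->
  exists g : bX -> R, [/\ continuous g, (forall z, 0 <= g z),
    (forall x, 0 < g (iX x)) & exists p, g p = 0].
Proof.
move=> /existsNP[f /not_implyP[cf fub]].
have f1 x : 0 < 1 + `|f x| by rewrite ltr_pwDl.
have f1n0 x : 1 + `|f x| != 0 by rewrite gt_eqF.
pose k (x : X) : R := (1 + `|f x|)^-1.
have ck : continuous k.
  move=> x; apply: cvgV => //; apply: cvgD; first exact: cvg_cst.
  by apply: cvg_norm; exact: cf.
have bk : [bounded k x | x in [set: X]].
  exists 1; split=> // M M1 x _ /=; rewrite (le_trans _ (ltW M1))//.
  by rewrite ger0_norm /k ?invr_ge0 ?(ltW (f1 x))// invf_le1// lerDl.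
have [g0 cg0 g0E] := stone_cech_extension ck bk.
pose g (z : bX) : R := `|g0 z|.
have cg : continuous g by exact: continuous_normr.
have gE x : g (iX x) = (1 + `|f x|)^-1.
  by rewrite /g g0E ger0_norm// invr_ge0 ltW.
exists g; split=> //.
- by move=> z; rewrite /g.
- by move=> x; rewrite gE invr_gt0.
(* Without a zero of g, 1/g would be continuous on the compact bX, hence bounded, and on X it equals
   1 + |f|. *)
apply: contrapT => /forallNP g_neq0; apply: fub.
have cVg : continuous (fun z => (g z)^-1).
  by apply: continuous_invr => // z; apply/eqP.
have [M gM] := compact_continuous_bounded (@stone_cech_compact R X) cVg.
exists M; split; rewrite ?num_real// => N MN x _ /=.
have := gM (iX x); rewrite gE invrK ger0_norm ?(ltW (f1 x))// => fM.
by rewrite (le_trans _ (ltW MN))// (le_trans _ fM)// lerDr.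
Qed.

Lemma P_sigma_dirac_mix (s : R) (s01 : 0 <= s <= 1) (x y : X) :
  P_sigma R X (dirac_mix (@stone_cech_compact R X) (@stone_cech_hausdorff R X)
    s01 (iX x) (iX y)).
Proof.
move=> K cK KX _; rewrite dirac_mixE; last first.
  exact: compact_borel (@stone_cech_hausdorff R X) cK.
rewrite !indicE !memNset ?mule0 ?adde0//; by move=> /KX; apply; exact: imageT.
Qed.

(** The zero set of g is compact, misses X, and is the intersection of the open sets where g <
    1/(n+1); membership in P_sigma(X) therefore makes it null. *)
Lemma P_sigma_Rintegral_gt0 (g : bX -> R) (nu : radon_probability R bX) :
  continuous g -> (forall z, 0 <= g z) -> (forall x, 0 < g (iX x)) ->
  P_sigma R X nu -> 0 < \int[nu]_x g x.
Proof.
move=> cg g0 gX nuX; apply: (radon_Rintegral_gt0 (@stone_cech_compact R X)) => //.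
have clK : closed (g @^-1` [set 0]).
  by apply: preimage_closed; [move=> z _; exact: cg|exact: closed_eq].
apply: nuX.
- exact: (subclosed_compact clK (@stone_cech_compact R X)).
- by move=> z /= gz [x _ xz]; have := gX x; rewrite xz gz ltxx.
exists (fun n => g @^-1` [set r | r < n.+1%:R^-1]).
  by move=> n; move/continuousP : cg; apply; exact: open_lt.
apply/seteqP; split=> z /=; first by move=> gz n _ /=; rewrite gz invr_gt0.
move=> gz; apply/eqP; rewrite eq_le g0 andbT leNgt; apply/negP => gz0.
have [n] := ltr_add_invr gz0; rewrite add0r => ng.
by have := lt_trans ng (gz n Logic.I); rewrite ltxx.
Qed.

End StoneCechFacts.

(** * Pseudocompactness and extension on P_sigma(X) *)

(** Shifting the index by one flips every sign, so a limit would equal its own opposite and be 0,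
    although all terms have absolute value 1. *)
Lemma not_cvg_signs {R : realType} (N : nat) (l : R) :
  ~ ((fun n => (-1) ^+ (n + N) : R) @ \oo --> l).
Proof.
move=> ul.
have ul' : (fun n => (-1) ^+ (n.+1 + N) : R) @ \oo --> l.
  by have := ul; rewrite -(cvg_shiftS (fun n => (-1) ^+ (n + N) : R)).
have Nul : (fun n => (-1) ^+ (n.+1 + N) : R) @ \oo --> - l.
  have -> : (fun n => (-1) ^+ (n.+1 + N) : R) = (fun n => - (-1) ^+ (n + N)).
    by apply/funext => n; rewrite addSn exprS mulN1r.
  exact: cvgN.
have l0 : l = 0.
  have : l = - l by apply: (cvg_unique (@Rhausdorff R) ul' Nul).
  by move=> lNl; lra.
have : (fun n => `|(-1) ^+ (n + N) : R|) @ \oo --> `|l| by apply: cvg_norm.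
have -> : (fun n => `|(-1) ^+ (n + N) : R|) = cst 1.
  by apply/funext => n; rewrite normrX normrN1 expr1n.
move/(cvg_unique (@Rhausdorff R) (cvg_cst (1 : R))); rewrite l0 normr0 => /eqP.
by rewrite oner_eq0.
Qed.

Lemma cos_natpi {R : realType} n : cos (n%:R * pi : R) = (-1) ^+ n.
Proof.
elim: n => [|n IH]; first by rewrite mul0r cos0 expr0.
by rewrite -natr1 mulrDl mul1r cosDpi IH exprS mulN1r.
Qed.

Section Implications.
Context {R : realType} {X : topologicalType}.
Local Notation bX := (stone_cech R X).
Local Notation iX := (@to_stone_cech R X).
Local Notation cbX := (@stone_cech_compact R X).
Local Notation hbX := (@stone_cech_hausdorff R X).
Local Notation PbX := (radon_probability R (stone_cech R X)).

Definition P_sigma_mix (s : R) (s01 : 0 <= s <= 1) (x y : X) : P_sigma R X :=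
  exist (fun nu => nu \in P_sigma R X) (dirac_mix cbX hbX s01 (iX x) (iX y))
    (mem_set (P_sigma_dirac_mix s01 x y)).

Lemma P_sigma_Rintegral_continuous (g : bX -> R) : continuous g ->
  continuous (fun nu : P_sigma R X => \int[set_val nu]_x g x).
Proof.
move=> cg nu; apply: (@continuous_comp (P_sigma R X) PbX R set_val
  (fun nu => \int[nu]_x g x)).
  exact: initial_continuous.
exact: continuous_Rintegral.
Qed.

Lemma pseudocompact_P_sigma :
  pseudocompact_space R (P_sigma R X) -> pseudocompact_space R X.
Proof.
move=> psP; apply: contrapT => /not_pseudocompact_zero[g [cg g0 gX [p gp0]]].
pose F (nu : P_sigma R X) : R := \int[set_val nu]_x g x.
have F0 nu : 0 < F nu.
  by apply: P_sigma_Rintegral_gt0 => //; exact: set_valP.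
have cF : continuous F by exact: P_sigma_Rintegral_continuous.
have cVF : continuous (fun nu => (F nu)^-1).
  by apply: continuous_invr => // nu; rewrite gt_eqF.
have [M0 [_ FM]] := psP _ cVF.
pose M := `|M0| + 1.
have M_gt0 : 0 < M by rewrite ltr_wpDl.
have [|x gx] := @stone_cech_lt _ _ g p M^-1 cg; first by rewrite gp0 invr_gt0.
have z01 : 0 <= (0 : R) <= 1 by rewrite lexx ler01.
have M0M : M0 < M by rewrite /M (le_lt_trans (ler_norm M0))// ltrDl.
(* With s = 0 this is the point mass at x, where F takes the value g(x) < 1/M. *)
have := FM M M0M (P_sigma_mix z01 x x) Logic.I.
rewrite /F/= Rintegral_dirac_mix// mul0r addr0 subr0 mul1r => Mg.
suff : M < M by rewrite ltxx.
apply: lt_le_trans Mg.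
by rewrite ger0_norm ?invr_ge0// -[X in X < _]invrK ltf_pV2 ?posrE ?invr_gt0.
Qed.

Lemma Cstar_embedded_P_sigma :
  Cstar_embedded R (P_sigma R X) -> pseudocompact_space R X.
Proof.
move=> ceP; apply: contrapT => /not_pseudocompact_zero[g [cg g0 gX [p gp0]]].
pose F (nu : P_sigma R X) : R := \int[set_val nu]_x g x.
have F0 nu : 0 < F nu.
  by apply: P_sigma_Rintegral_gt0 => //; exact: set_valP.
have cF : continuous F by exact: P_sigma_Rintegral_continuous.
have cVF : continuous (fun nu => (F nu)^-1).
  by apply: continuous_invr => // nu; rewrite gt_eqF.
have cosF : continuous (fun nu => cos (F nu)^-1).
  move=> nu; apply: (@continuous_comp _ _ _ (fun nu => (F nu)^-1) cos).
    exact: cVF.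
  exact: continuous_cos.
have [|G cG GE] := ceP _ cosF.
  exists 1; split=> // M M1 nu _ /=; apply: le_trans (ltW M1).
  by rewrite ler_norml cos_geN1 cos_le1.
have [|x0 _] := @stone_cech_lt _ _ g p 1 cg; first by rewrite gp0.
pose q := iX x0; pose c := g q.
have c0 : 0 < c by exact: gX.
(* Both sides are continuous in p as long as s > 0, and agree for p in X. *)
have GmixE (s : R) (s01 : 0 <= s <= 1) : 0 < s ->
    G (dirac_mix cbX hbX s01 p q) = cos (s * c)^-1.
  move=> s0; have s1 : 0 <= 1 - s by have /andP[_] := s01; rewrite subr_ge0.
  pose k (y : bX) : R := (1 - s) * g y + s * c.
  have k0 y : k y != 0 by rewrite gt_eqF// ltr_wpDl ?mulr_ge0 ?mulr_gt0.
  have ck : continuous k.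
    move=> y; apply: (@continuous_comp _ _ _ g (fun r => (1 - s) * r + s * c)).
      exact: cg.
    by apply: cvgD; [apply: cvgM; [exact: cvg_cst|exact: cvg_id]|exact: cvg_cst].
  have -> : G (dirac_mix cbX hbX s01 p q) = cos (k p)^-1.
    move: p {gp0}; apply/funeqP; apply: stone_cech_eq.
    - move=> y; apply: (@continuous_comp _ _ _
        (fun y => dirac_mix cbX hbX s01 y q) G); last exact: cG.
      exact: dirac_mix_continuous_left.
    - move=> y; apply: (@continuous_comp _ _ _ (fun y => (k y)^-1) cos).
        exact: continuous_invr.
      exact: continuous_cos.
    - move=> x.
      have := GE (P_sigma_mix s01 x x0).
      by rewrite /F/= Rintegral_dirac_mix// => ->.
  by rewrite /k gp0 mulr0 add0r.
have cpi0 : 0 < c * pi by rewrite mulr_gt0// pi_gt0.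
have cpi_gt0 : 0 < (c * pi)^-1 by rewrite invr_gt0.
(* The weights are chosen so that 1/(s n * c) = (n + N + 1) pi, where the cosine is alternately 1
   and -1; the offset N keeps s n at most 1. *)
pose N := Num.truncn (c * pi)^-1.
pose s n : R := (c * pi)^-1 * (n + N).+1%:R^-1.
have s0 n : 0 < s n by rewrite mulr_gt0 ?invr_gt0.
have s01 n : 0 <= s n <= 1.
  rewrite ltW//= ler_pdivrMr// mul1r (@le_trans _ _ N.+1%:R)//.
    exact/ltW/truncnS_gt.
  by rewrite ler_nat ltnS leq_addl.
have z01 : 0 <= (0 : R) <= 1 by rewrite lexx ler01.
have cvs : s @ \oo --> (0 : R).
  rewrite -(mulr0 (c * pi)^-1); apply: cvgMr.
  by have := @cvg_harmonic R; rewrite -(cvg_shiftn N).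
apply: (@not_cvg_signs R N.+1 (G (dirac_mix cbX hbX z01 p q))).
have -> : (fun n => (-1) ^+ (n + N.+1)) = (fun n => G (dirac_mix cbX hbX (s01 n) p q)).
  apply/funext => n; rewrite GmixE// -cos_natpi; congr cos.
  have c_neq0 : c != 0 by rewrite gt_eqF.
  have pi_neq0 : pi != 0 :> R by rewrite gt_eqF// pi_gt0.
  have mE (a r : R) : a != 0 -> r != 0 -> r * a = ((c * a)^-1 / r * c)^-1.
    by move=> a_neq0 r_neq0; field; rewrite a_neq0 r_neq0 c_neq0.
  by rewrite /s addnS; apply: mE.
(* As s n tends to 0 the mixes converge to the point mass at p, so continuity of G would make the
   alternating signs converge. *)
apply: (@cvg_comp _ _ _ (fun n => dirac_mix cbX hbX (s01 n) p q) G); last exact: cG.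
exact: cvg_dirac_mix.
Qed.

(** * Consequences of P_sigma(X) being all of P(bX) *)

Section P_sigmaT.
Hypothesis PT : P_sigma R X = setT.

(** The inverse of [set_val]: [PT] identifies the two spaces up to homeomorphism, but the subspace
    type is not convertible to [PbX]. *)
Let toP (mu : PbX) : P_sigma R X :=
  exist _ mu (mem_set (eq_ind_r (fun A => A mu) Logic.I PT)).

Let toP_continuous : continuous toP.
Proof.
apply/continuousP => A [B oB <-]; rewrite (_ : _ @^-1` _ = B)//.
Qed.

Lemma P_sigmaT_pseudocompact : compact (P_sigma R X) ->
  pseudocompact_space R (P_sigma R X).
Proof.
move=> cP f cf.
have cPT : compact [set: PbX] by rewrite -PT.
have [|M fM] := compact_continuous_bounded cPT (_ : continuous (f \o toP)).
  by move=> mu; apply: continuous_comp; [exact: toP_continuous|exact: cf].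
exists M; split; rewrite ?num_real// => N MN nu _ /=.
have -> : nu = toP (set_val nu) by exact/val_inj.
exact: le_trans (fM _) (ltW MN).
Qed.

Lemma P_sigmaT_Cstar_embedded : Cstar_embedded R (P_sigma R X).
Proof.
move=> f cf _; exists (f \o toP).
  by move=> mu; apply: continuous_comp; [exact: toP_continuous|exact: cf].
by move=> nu /=; congr f; exact/val_inj.
Qed.
End P_sigmaT.

End Implications.

(** * Compact G_delta sets *)

Lemma near_ltn {T : topologicalType} (x : T) (P : nat -> T -> Prop) (N : nat) :
  (forall n, \forall y \near x, P n y) ->
  \forall y \near x, forall n, (n < N)%N -> P n y.
Proof.
move=> nP; elim: N => [|N IH]; first by near=> y.
near=> y => n; rewrite ltnS leq_eqVlt => /predU1P[->|nN].
  by near: y; exact: nP.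
by move: n nN; near: y.
Unshelve. all: by end_near. Qed.

Lemma ler_sup_add {R : realType} (a b : R^nat) (M e : R) :
  (forall n, b n <= M) -> (forall n, a n <= b n + e) ->
  sup (range a) <= sup (range b) + e.
Proof.
move=> bM ab; apply: ge_sup; first by exists (a 0%N); exists 0%N.
move=> _ [n _ <-]; apply: le_trans (ab n) _; rewrite lerD2r; apply: ub_le_sup.
  by exists M => _ [k _ <-].
by exists n.
Qed.

(** Urysohn functions [f n], equal to 0 at z and to 1 off [U n], are combined into the supremum of
    [f n / (n+1)]. The decaying weights make the supremum continuous, and it vanishes only where
    every [f n] does. *)
Lemma normal_Gdelta_zero {R : realType} {T : topologicalType} (z : T)
    (U : nat -> set T) :
  normal_space T -> closed [set z] -> (forall n, open (U n)) ->
  (forall n, U n z) ->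
  exists g : T -> R, [/\ continuous g, (forall x, 0 <= g x), g z = 0 &
    forall x, g x = 0 -> forall n, U n x].
Proof.
move=> nT clz oU Uz.
have /choice[f fP] n : exists f : T -> R, [/\ continuous f,
    (forall x, 0 <= f x <= 1), f z = 0 & forall x, ~ U n x -> f x = 1].
  have clU : closed (~` U n) by exact: open_closedC.
  have zU : [set z] `&` ~` U n = set0.
    by apply/seteqP; split=> // x [/= ->]; apply; exact: Uz.
  move/normal_separatorP : (nT) => /(_ R _ _ clz clU zU).
  move=> /(@uniform_separatorP _ R)[f [cf f01 fz fU]].
  exists f; split=> //.
  - by move=> x; have /f01 : range f (f x) by exact: imageT.
  - by apply: fz; exists z.
  - by move=> x Ux; apply: fU; exists x.
pose a (x : T) : R^nat := fun n => f n x / n.+1%:R.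
have a0 x n : 0 <= a x n by have [_ /(_ x)/andP[? _] _ _] := fP n; rewrite divr_ge0.
have aV x n : a x n <= n.+1%:R^-1.
  by have [_ /(_ x)/andP[_ ?] _ _] := fP n; rewrite ler_piMl// invr_ge0.
have a1 x n : a x n <= 1.
  by rewrite (le_trans (aV x n))// invf_le1// ler1n.
have ag x n : a x n <= sup (range (a x)).
  by apply: ub_le_sup; [exists 1 => _ [k _ <-]|exists n].
exists (fun x => sup (range (a x))); split.
- move=> x; apply/cvgrPdist_le => e e0.
  have [N Ne] := ltr_add_invr e0; rewrite add0r in Ne.
  have nx n : \forall y \near x, `|f n x - f n y| <= e.
    by have [cf _ _ _] := fP n; move/cvgrPdist_le : (cf x); exact.
  near=> y.
  suff axy n : a x n <= a y n + e /\ a y n <= a x n + e.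
    rewrite ler_distl lerBlDr !(ler_sup_add (a1 _))//; by move=> n; have [] := axy n.
  (* The finitely many indices below N are controlled by continuity of [f n]; beyond N both terms
     already lie between 0 and e. *)
  have [nN|Nn] := ltnP n N.
    have : `|f n x - f n y| <= e by move: n nN; near: y; exact: near_ltn.
    have v0 : 0 <= n.+1%:R^-1 :> R by rewrite invr_ge0.
    have v1 : n.+1%:R^-1 <= 1 :> R by rewrite invf_le1// ler1n.
    move=> fe; have : `|a x n - a y n| <= e.
      rewrite /a -mulrBl normrM (ger0_norm v0) (le_trans _ fe)//.
      by rewrite ler_piMr.
    by rewrite ler_norml => /andP[h1 h2]; split; lra.
  have ne : n.+1%:R^-1 <= e.
    by rewrite (le_trans _ (ltW Ne))// lef_pV2 ?posrE// ler_nat.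
  by split; rewrite (le_trans (aV _ n))// (le_trans ne)// lerDr.
- by move=> x; exact: le_trans (ag x 0%N).
- apply/eqP; rewrite eq_le (le_trans _ (ag z 0%N))// andbT.
  apply: ge_sup; first by exists (a z 0%N); exists 0%N.
  by move=> _ [n _ <-]; rewrite /a; have [_ _ -> _] := fP n; rewrite mul0r.
- move=> x gx n; apply: contrapT => Ux; have := ag x n.
  have [_ _ _ fU] := fP n; rewrite gx /a fU// mul1r leNgt.
  by rewrite invr_gt0 ltr0n.
Unshelve. all: by end_near. Qed.

(** A point z of K would give a continuous g >= 0 with g(z) = 0 and all zeros in K. Then 1/g is
    continuous on X, and unbounded there because X is dense in bX. *)
Lemma pseudocompact_Gdelta {R : realType} {X : topologicalType} :
  tychonoff_space X -> pseudocompact_space R X ->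
  forall K : set (stone_cech R X), K `<=` ~` range (@to_stone_cech R X) ->
  Gdelta K -> K = set0.
Proof.
move=> tX psX K KX [U oU KE]; apply/seteqP; split=> // z Kz.
have hb := @stone_cech_hausdorff R X.
have nb := compact_normal hb (@stone_cech_compact R X).
have clz : closed [set z] by exact/accessible_closed_set1/hausdorff_accessible.
have Uz n : U n z by move: Kz; rewrite KE; exact.
have [g [cg g0 gz gU]] := @normal_Gdelta_zero R _ z U nb clz oU Uz.
have gX x : g (to_stone_cech R x) != 0.
  apply/eqP => gx; apply: (KX (to_stone_cech R x)); last exact: imageT.
  by rewrite KE => n _; exact: gU.
have cgi : continuous (g \o @to_stone_cech R X).
  move=> x; apply: continuous_comp; first exact: to_stone_cech_continuous.
  exact: cg.
have [M0 [_ gM]] := psX _ (continuous_invr gX cgi).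
pose M := `|M0| + 1.
have M_gt0 : 0 < M by rewrite ltr_wpDl.
have [|x gx] := @stone_cech_lt _ _ g z M^-1 cg; first by rewrite gz invr_gt0.
have M0M : M0 < M by rewrite /M (le_lt_trans (ler_norm M0))// ltrDl.
have gx_gt0 : 0 < g (to_stone_cech R x) by rewrite lt0r gX g0.
have := gM M M0M x Logic.I => /=.
rewrite ger0_norm ?invr_ge0// leNgt => /negP; apply.
by rewrite -[X in X < _]invrK ltf_pV2 ?posrE ?invr_gt0.
Qed.

(** * Contents on compact spaces *)

Section ContentExtension.
Context {R : realType} {T : topologicalType}.
Hypotheses (cT : compact [set: T]) (hT : hausdorff_space T).
Variable lam : set T -> R.
Hypothesis lam_ge0 : forall C, closed C -> 0 <= lam C.
Hypothesis lamT : lam setT = 1.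
Hypothesis le_lam : forall C D, closed C -> closed D -> C `<=` D -> lam C <= lam D.
Hypothesis lamU_le : forall C D, closed C -> closed D ->
  lam (C `|` D) <= lam C + lam D.
Hypothesis lamU_ge : forall C D, closed C -> closed D -> C `&` D = set0 ->
  lam C + lam D <= lam (C `|` D).

Local Open Scope ereal_scope.

Definition inner_content (U : set T) : \bar R :=
  ereal_sup [set (lam C)%:E | C in [set C | closed C /\ C `<=` U]].

Definition outer_content (A : set T) : \bar R :=
  ereal_inf [set inner_content U | U in [set U | open U /\ A `<=` U]].

Lemma content0 : lam set0 = 0%R.
Proof.
have := lamU_ge (@closed0 T) (@closed0 T) (setI0 _).
by rewrite setU0 => h; have := lam_ge0 (@closed0 T); lra.
Qed.

Lemma content_le1 C : closed C -> (lam C <= 1)%R.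
Proof. by move=> cC; rewrite -lamT; apply: le_lam => //; exact: closedT. Qed.

Lemma content_le_inner C U : closed C -> C `<=` U -> (lam C)%:E <= inner_content U.
Proof. by move=> cC CU; apply: ereal_sup_ubound; exists C. Qed.

Lemma inner_content_ge0 U : 0 <= inner_content U.
Proof.
apply: (@le_trans _ _ (lam set0)%:E); first by rewrite content0.
by apply: content_le_inner => //; exact: closed0.
Qed.

Lemma inner_content_le1 U : inner_content U <= 1.
Proof.
apply: ge_ereal_sup => _ [C [cC _] <-]; rewrite lee_fin; exact: content_le1.
Qed.

Lemma le_inner_content U V : U `<=` V -> inner_content U <= inner_content V.
Proof.
move=> UV; apply: ereal_sup_le => _ [C [cC CU] <-].
by exists C => //; split=> //; exact: subset_trans UV.
Qed.

Lemma outer_content_le A U : open U -> A `<=` U -> outer_content A <= inner_content U.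
Proof. by move=> oU AU; apply: ereal_inf_lbound; exists U. Qed.

Lemma outer_content_ge0 A : 0 <= outer_content A.
Proof.
by apply: le_ereal_inf_tmp => _ [U _ <-]; exact: inner_content_ge0.
Qed.

Lemma outer_content_le1 A : outer_content A <= 1.
Proof.
by apply: le_trans (inner_content_le1 setT); apply: outer_content_le => //; exact: openT.
Qed.

Lemma outer_content_fin A : outer_content A \is a fin_num.
Proof.
by rewrite ge0_fin_numE ?outer_content_ge0// (le_lt_trans (outer_content_le1 A))// ltry.
Qed.

Lemma outer_content_open U : open U -> outer_content U = inner_content U.
Proof.
move=> oU; apply/eqP; rewrite eq_le outer_content_le//=.
by apply: le_ereal_inf_tmp => _ [V [oV UV] <-]; exact: le_inner_content.
Qed.

Lemma le_outer_content : {homo outer_content : A B / A `<=` B >-> A <= B}.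
Proof.
move=> A B AB; apply: le_ereal_inf_tmp => _ [U [oU BU] <-].
by apply: outer_content_le => //; exact: subset_trans BU.
Qed.

(** [C \ U] and [C \ V] are disjoint closed sets; normality separates them by open sets, and
    removing each of these from C leaves the two pieces. *)
Lemma closed_splitU C U V : closed C -> open U -> open V -> C `<=` U `|` V ->
  exists C1 C2 : set T, [/\ closed C1, closed C2, C1 `<=` U, C2 `<=` V & C = C1 `|` C2].
Proof.
move=> cC oU oV CUV.
have /normal_openP nT := compact_normal hT cT.
have cU : closed (C `\` U) by rewrite setDE; apply: closedI => //; exact: open_closedC.
have cV : closed (C `\` V) by rewrite setDE; apply: closedI => //; exact: open_closedC.
have [|U' [V' [oU' oV' CU' CV' UV']]] := nT R _ _ cU cV.
  by apply/seteqP; split=> // x [[Cx Ux] [_ Vx]]; case: (CUV x Cx).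
exists (C `\` U'), (C `\` V'); split.
- by rewrite setDE; apply: closedI => //; exact: open_closedC.
- by rewrite setDE; apply: closedI => //; exact: open_closedC.
- by move=> x [Cx Ux']; apply: contrapT => Ux; apply: Ux'; exact: CU'.
- by move=> x [Cx Vx']; apply: contrapT => Vx; apply: Vx'; exact: CV'.
- apply/seteqP; split=> x; last by case=> -[].
  move=> Cx; have [Ux|Ux] := pselect (U' x); last by left.
  right; split=> // Vx.
  by have : (U' `&` V') x by []; rewrite UV'.
Qed.

Lemma content_le_finite_sum (U : (set T)^nat) N C : (forall n, open (U n)) ->
  closed C -> C `<=` \bigcup_(n < N) U n ->
  (lam C)%:E <= \sum_(n < N) inner_content (U n).
Proof.
move=> oU; elim: N C => [|N IH] C cC CU.
  rewrite big_ord0 (_ : C = set0) ?content0//.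
  by apply/seteqP; split=> // x /CU[].
have [|||C1 [C2 [cC1 cC2 C1U C2U ->]]] := @closed_splitU C (\bigcup_(n < N) U n) (U N) cC.
- by apply: bigcup_open => n _.
- exact: oU.
- move=> x /CU[n/= nN Unx]; move: nN; rewrite ltnS leq_eqVlt => /predU1P[nN|nN].
    by right; rewrite -nN.
  by left; exists n.
rewrite big_ord_recr/= (@le_trans _ _ ((lam C1)%:E + (lam C2)%:E))//.
  by rewrite -EFinD lee_fin lamU_le.
by apply: leeD; [exact: IH|exact: content_le_inner].
Qed.

(** A closed set inside the union is compact, so finitely many of the [U n] already cover it. *)
Lemma inner_content_bigcup (U : (set T)^nat) : (forall n, open (U n)) ->
  inner_content (\bigcup_n U n) <= \sum_(n <oo) inner_content (U n).
Proof.
move=> oU; apply: ge_ereal_sup => _ [C [cC CU] <-].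
have cpC : compact C by exact: subclosed_compact cC cT _.
have [|N _ /(_ N (leqnn N)) CN] := (compact_near_coveringP C).1 cpC nat \oo
    (fun N x => (\bigcup_(n < N) U n) x).
  move=> x /CU[n _ Unx]; exists (U n, [set N | (n < N)%N]).
    by split=> /=; [exact: open_nbhs_nbhs|exists n.+1].
  by move=> [y N]/= [Uny nN]; exists n.
apply: (@le_trans _ _ (\sum_(n < N) inner_content (U n))).
  exact: content_le_finite_sum.
rewrite -(big_mkord xpredT (fun n => inner_content (U n))).
by apply: nneseries_lim_ge => *; exact: inner_content_ge0.
Qed.

Lemma outer_content_sigma_subadditive : sigma_subadditive outer_content.
Proof.
move=> A; apply/lee_addgt0Pr => e e0.
have /choice[U UP] n : exists U, [/\ open U, A n `<=` U &
    inner_content U <= outer_content (A n) + (e / (2 ^ n.+1)%:R)%:E].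
  have en : (0 < e / (2 ^ n.+1)%:R)%R by rewrite divr_gt0// ltr0n expn_gt0.
  have := lb_ereal_inf_adherent en (outer_content_fin (A n)).
  by move=> [_ [U [oU AU] <-] /ltW ?]; exists U.
apply: (@le_trans _ _ (\sum_(n <oo) inner_content (U n))).
  apply: le_trans (inner_content_bigcup _); last by move=> n; have [] := UP n.
  apply: outer_content_le; first by apply: bigcup_open => n _; have [] := UP n.
  by move=> x [n _ Anx]; exists n => //; have [_ + _] := UP n; exact.
apply: le_trans (epsilon_trick _ _ (ltW e0)).
  apply: lee_nneseries => n *; [exact: inner_content_ge0|by have [] := UP n].
by move=> n; exact: outer_content_ge0.
Qed.

Let outer_content0 : outer_content set0 = 0.
Proof.
apply/eqP; rewrite eq_le outer_content_ge0 andbT outer_content_open; last exact: open0.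
apply: ge_ereal_sup => _ [C [cC CU] <-].
by rewrite (_ : C = set0) ?content0//; apply/seteqP; split.
Qed.

HB.instance Definition _ := isOuterMeasure.Build R T outer_content
  outer_content0 outer_content_ge0 le_outer_content outer_content_sigma_subadditive.

(** The test set is enlarged to an open V. For closed C inside V and U, and closed D inside [V \ C],
    disjointness gives lam D + lam C <= lam (D [|] C), which is at most the inner content of V;
    suprema over D and then over C finish. *)
Lemma open_caratheodory U : open U -> outer_content.-caratheodory U.
Proof.
move=> oU; apply: le_caratheodory_measurable => X.
apply: le_ereal_inf_tmp => _ [V [oV XV] <-].
apply: (@le_trans _ _ (outer_content (V `&` U) + outer_content (V `&` ~` U))).
  by apply: leeD; apply: le_outer_content; exact: setSI.
rewrite outer_content_open; last exact: openI.
rewrite -leeBrDr ?outer_content_fin//.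
apply: ge_ereal_sup => _ [C [cC CVU] <-].
rewrite leeBrDr ?outer_content_fin// addeC -leeBrDr//.
have oVC : open (V `\` C) by rewrite setDE; apply: openI => //; exact: closed_openC.
apply: (@le_trans _ _ (inner_content (V `\` C))).
  by apply: outer_content_le => // x [Vx Ux]; split=> // /CVU[].
apply: ge_ereal_sup => _ [D [cD DVC] <-].
rewrite leeBrDr// -EFinD (@le_trans _ _ (lam (D `|` C))%:E)//.
  rewrite lee_fin; apply: lamU_ge => //.
  by apply/seteqP; split=> // x [/DVC[]].
apply: content_le_inner; first exact: closedU.
by move=> x [/DVC[]|/CVU[]].
Qed.

Let T_neq0 : $|T|.
Proof.
have [x _] : [set: T] !=set0.
  apply/set0P/eqP => T0; have := lamT; rewrite T0 content0 => /eqP.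
  by rewrite eq_sym oner_eq0.
exact: squash x.
Qed.

Let borel_caratheodory (A : set T) : <<s open >> A -> outer_content.-caratheodory A.
Proof.
move: A; apply: smallest_sub; last by move=> U; exact: open_caratheodory.
exact: (sigma_algebra_measurable (caratheodory_type
  (outer_content : set (pointed_at T_neq0) -> \bar R))).
Qed.

(** The outer measure is retyped so that its measure structure refers to the Borel sets rather than
    to the Carathéodory sigma-algebra. *)
Definition content_measure : set (borel T_neq0) -> \bar R := outer_content.

Let content_measure_sigma_additive : semi_sigma_additive content_measure.
Proof.
move=> A mA tA mUA.
apply: (@caratheodory_measure_sigma_additive R (pointed_at T_neq0) outer_content) => //.
- by move=> n; exact: borel_caratheodory (mA n).
- exact: borel_caratheodory mUA.
Qed.

HB.instance Definition _ := isMeasure.Build _ _ _ content_measure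
  outer_content0 outer_content_ge0 content_measure_sigma_additive.

Let content_measureT : content_measure setT = 1.
Proof.
rewrite /content_measure outer_content_open; last exact: openT.
by apply/eqP; rewrite eq_le inner_content_le1 -lamT content_le_inner//; exact: closedT.
Qed.

HB.instance Definition _ :=
  Measure_isProbability.Build _ _ _ content_measure content_measureT.

Lemma radon_of_content : exists nu : radon_probability R T,
  forall U, open U -> nu U = inner_content U.
Proof.
have [|nu nuE] := @radon_probability_exists R T T_neq0 content_measure; last first.
  exists nu => U oU; rewrite nuE; last exact: sub_sigma_algebra.
  exact: outer_content_open.
move=> A mA e e0.
(* Inner regularity of A is outer regularity of its complement: an open U that nearly fits around
   the complement of A has a compact complement inside A. *)
have := lb_ereal_inf_adherent e0 (outer_content_fin (~` A)).
move=> [_ [U [oU AU] <-] Ue].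
have mU : measurable (U : set (borel T_neq0)) by exact: sub_sigma_algebra.
exists (~` U); split.
- by apply: subclosed_compact cT _ => //; exact: open_closedC.
- exact: (@measurableC _ (borel T_neq0)).
- by apply/subsetCP; rewrite setCK.
- rewrite (_ : A `\` ~` U = U `\` ~` A); last by rewrite !setDE !setCK setIC.
  have mAc : measurable (~` A : set (borel T_neq0)).
    exact: (@measurableC _ (borel T_neq0)).
  rewrite (measureD mU mAc).
    rewrite (setIidr AU) lteBlDl.
    by move: Ue; rewrite -(outer_content_open oU); apply.
    exact: outer_content_fin.
  exact: le_lt_trans (outer_content_le1 U) (ltry _).
Qed.
End ContentExtension.

(** * Compactness of the space of Radon probabilities *)

(** The image of F has a cluster point in the compact segment, and an ultrafilter converges to each
    of its cluster points. *)
Lemma ultra_bounded_cvg {R : realType} {S : Type} (F : set_system S)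
    (phi : S -> R) (a b : R) : UltraFilter F -> (forall s, a <= phi s <= b) ->
  exists2 l, a <= l <= b & phi @ F --> l.
Proof.
move=> UF ab.
have [|l [abl cll]] := @segment_compact R a b (phi @ F) _.
  change (F (phi @^-1` `[a, b]%classic)).
  by apply: filterE => s /=; rewrite in_itv/=.
exists l; first by move: abl; rewrite /= in_itv.
move=> N Nl; have [//|FN] := in_ultra_setVsetC (phi @^-1` N) UF.
by have [r [/= nNr Nr]] := cll (~` N) N FN Nl; case: nNr.
Qed.

Section RadonSpaceCompact.
Context {R : realType} {T : topologicalType}.
Hypotheses (cT : compact [set: T]) (hT : hausdorff_space T).
Local Notation P := (radon_probability R T).

Lemma closed_borel (C : set T) : closed C -> <<s open >> C.
Proof. by move=> cC; apply: compact_borel => //; exact: subclosed_compact cC cT _. Qed.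

Lemma radon_fine_bounds (mu : P) A : <<s open >> A -> 0 <= fine (mu A) <= 1.
Proof.
move=> mA; rewrite fine_ge0//= -lee_fin fineK; last exact: fin_num_measure.
exact: probability_le1.
Qed.

Section UltraLimit.
Variable F : set_system P.
Hypothesis UF : UltraFilter F.

(** Countable additivity may be lost in the limit, so this serves only as a content on closed sets
    and as an upper bound on open ones. *)
Definition ultra_mass (A : set T) : R := lim ((fun mu : P => fine (mu A)) @ F).

Lemma cvg_ultra_mass A : <<s open >> A ->
  (fun mu : P => fine (mu A)) @ F --> ultra_mass A.
Proof.
move=> mA; have [l _ Fl] := ultra_bounded_cvg UF (fun mu => radon_fine_bounds mu mA).
by apply/cvg_ex; exists l.
Qed.

Lemma ultra_mass_ge0 A : <<s open >> A -> 0 <= ultra_mass A.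
Proof.
move=> mA; apply: limr_ge; first exact: cvg_ultra_mass.
by apply: filterE => mu; have /andP[] := radon_fine_bounds mu mA.
Qed.

Lemma le_ultra_mass A B : <<s open >> A -> <<s open >> B -> A `<=` B ->
  ultra_mass A <= ultra_mass B.
Proof.
move=> mA mB AB; apply: ler_lim; [exact: cvg_ultra_mass|exact: cvg_ultra_mass|].
apply: filterE => mu; apply: fine_le; [exact: fin_num_measure..|].
by apply: le_measure => //; rewrite inE.
Qed.

Lemma ultra_massT : ultra_mass setT = 1.
Proof.
apply: cvg_lim => //; rewrite (_ : (fun mu : P => _) = cst 1); first exact: cvg_cst.
by apply/funext => mu; rewrite probability_setT.
Qed.

Lemma ultra_massU_le C D : closed C -> closed D ->
  ultra_mass (C `|` D) <= ultra_mass C + ultra_mass D.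
Proof.
move=> cC cD; have mC := closed_borel cC; have mD := closed_borel cD.
have mCD : <<s open >> (C `|` D) by apply: closed_borel; exact: closedU.
have CDl : (fun mu : P => fine (mu C) + fine (mu D)) @ F -->
    ultra_mass C + ultra_mass D by apply: cvgD; exact: cvg_ultra_mass.
rewrite -(cvg_lim _ CDl)//; apply: ler_lim; [exact: cvg_ultra_mass|exact: cvgP CDl|].
apply: filterE => mu.
change (fine (mu (C `|` D)) <= fine (mu C) + fine (mu D)).
rewrite -fineD; [|exact: fin_num_measure..].
apply: fine_le; [exact: fin_num_measure|by rewrite fin_numD !fin_num_measure|].
exact: measureU2.
Qed.

Lemma ultra_massU_ge C D : closed C -> closed D -> C `&` D = set0 ->
  ultra_mass C + ultra_mass D <= ultra_mass (C `|` D).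
Proof.
move=> cC cD CD0; have mC := closed_borel cC; have mD := closed_borel cD.
have mCD : <<s open >> (C `|` D) by apply: closed_borel; exact: closedU.
have CDl : (fun mu : P => fine (mu C) + fine (mu D)) @ F -->
    ultra_mass C + ultra_mass D by apply: cvgD; exact: cvg_ultra_mass.
rewrite -(cvg_lim _ CDl)//; apply: ler_lim; [exact: cvgP CDl|exact: cvg_ultra_mass|].
apply: filterE => mu.
change (fine (mu C) + fine (mu D) <= fine (mu (C `|` D))).
rewrite -fineD; [|exact: fin_num_measure..].
by rewrite -measureU.
Qed.

(** The bound is one-sided because regularization keeps only the limit masses of closed subsets of
    U; it is the open-set half of the portmanteau theorem, along F. *)
Lemma ultra_mass_radon : exists nu : P,
  forall U, open U -> fine (nu U) <= ultra_mass U.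
Proof.
have [|||||nu nuE] := @radon_of_content R T cT hT ultra_mass.
- by move=> C cC; apply: ultra_mass_ge0; exact: closed_borel.
- exact: ultra_massT.
- by move=> C D cC cD; apply: le_ultra_mass; exact: closed_borel.
- exact: ultra_massU_le.
- exact: ultra_massU_ge.
exists nu => U oU; have mU : <<s open >> U by exact: sub_sigma_algebra.
rewrite -lee_fin fineK; last exact: fin_num_measure.
rewrite nuE//; apply: ge_ereal_sup => _ [C [cC CU] <-]; rewrite lee_fin.
by apply: le_ultra_mass => //; exact: closed_borel.
Qed.

(* Layer-cake sums reduce the integral to finitely many open sets. *)
Lemma ultra_Rintegral_le01 (nu : P) (f : T -> R) (l : R) :
  (forall U, open U -> fine (nu U) <= ultra_mass U) ->
  continuous f -> (forall x, 0 <= f x <= 1) ->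
  (fun mu : P => \int[mu]_x f x) @ F --> l -> \int[nu]_x f x <= l.
Proof.
move=> nuU cf f01 Fl; apply/ler_addgt0Pr => e e0.
have [n ne] := ltr_add_invr e0; rewrite add0r in ne.
pose U (k : nat) : set T := [set x | k.+1%:R / n.+1%:R < f x].
have oU k : open (U k) by move/continuousP : cf => /(_ _ (@open_gt _ _)); exact.
pose S (m : P) := n.+1%:R^-1 * \sum_(k < n.+1) fine (m (U k)).
pose S_F := n.+1%:R^-1 * \sum_(k < n.+1) ultra_mass (U k).
have layer (m : P) : S m <= \int[m]_x f x <= S m + n.+1%:R^-1.
  exact: (Rintegral_layer m n (measurable_borel_continuous cf) f01).
have sumF : (fun m : P => \sum_(k < n.+1) fine (m (U k))) @ F -->
    \sum_(k < n.+1) ultra_mass (U k).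
  apply: cvg_big => [|k _]; first exact: add_continuous.
  by apply: cvg_ultra_mass; exact: sub_sigma_algebra.
have SF : S @ F --> S_F by exact: cvgMr.
have S_Fl : S_F <= l.
  rewrite -(cvg_lim _ SF)// -(cvg_lim _ Fl)//.
  apply: ler_lim; [exact: cvgP SF|exact: cvgP Fl|].
  by apply: filterE => mu; have /andP[] := layer mu.
have /andP[_ nuS] := layer nu; apply: le_trans nuS _; apply: lerD; last exact: ltW.
apply: le_trans S_Fl; rewrite ler_wpM2l ?invr_ge0//.
by apply: ler_sum => k _; exact: nuU.
Qed.

Lemma ultra_Rintegral_le (nu : P) (f : T -> R) (l : R) :
  (forall U, open U -> fine (nu U) <= ultra_mass U) -> continuous f ->
  (fun mu : P => \int[mu]_x f x) @ F --> l -> \int[nu]_x f x <= l.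
Proof.
move=> nuU cf Fl; have [M0 fM0] := compact_continuous_bounded cT cf.
pose M := `|M0| + 1; have M_gt0 : 0 < M by rewrite ltr_wpDl.
have fM x : - M <= f x <= M.
  rewrite -ler_norml (le_trans (fM0 x))// (le_trans (ler_norm _))//.
  by rewrite /M lerDl.
(* An affine change of f into [0, 1]; integrals against probability measures undergo the same
   change. *)
pose g x := (2 * M)^-1 * (f x + M).
have M2_gt0 : 0 < 2 * M by rewrite mulr_gt0.
have cfM : continuous (fun x => f x + M).
  by move=> x; apply: cvgD; [exact: cf|exact: cvg_cst].
have cg : continuous g.
  by move=> x; apply: cvgMr; exact: cfM.
have g01 x : 0 <= g x <= 1.
  have /andP[f1 f2] := fM x; rewrite /g mulr_ge0 ?invr_ge0 ?(ltW M2_gt0)//=.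
    by rewrite ler_pdivrMl// mulr1; lra.
  by lra.
have gE (m : P) : \int[m]_x g x = (2 * M)^-1 * (\int[m]_x f x + M).
  rewrite RintegralZl//; last exact: radon_integrable.
  rewrite RintegralD//; [|exact: radon_integrable|].
    by rewrite Rintegral_probability_cst.
  by apply: (radon_integrable cT m (f := cst M)); exact: cst_continuous.
have Fg : (fun m : P => \int[m]_x g x) @ F --> (2 * M)^-1 * (l + M).
  rewrite (_ : (fun m : P => _) = fun m : P => (2 * M)^-1 * (\int[m]_x f x + M)).
    by apply: cvgMr; apply: cvgD => //; exact: cvg_cst.
  by apply/funext.
have := ultra_Rintegral_le01 nuU cg g01 Fg.
by rewrite gE ler_pM2l ?invr_gt0// lerD2r.
Qed.

Lemma ultra_radon_cvg : exists nu : P, F --> nu.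
Proof.
have [nu nuU] := ultra_mass_radon.
exists nu; apply: cvg_radon => f cf.
have [M fM] := compact_continuous_bounded cT cf.
have intM (m : P) : - M <= \int[m]_x f x <= M.
  by rewrite -ler_norml Rintegral_bounded//; exact: measurable_borel_continuous.
have [l _ Fl] := ultra_bounded_cvg UF intM.
suff -> : \int[nu]_x f x = l by [].
(* The upper bound for f is one half; the same bound for -f gives the other. *)
apply/eqP; rewrite eq_le (ultra_Rintegral_le nuU cf Fl)/=.
have intN (m : P) : \int[m]_x (- f x) = - \int[m]_x f x.
  rewrite -mulN1r -RintegralZl//; last exact: radon_integrable.
  by under eq_Rintegral do rewrite -mulN1r.
have cNf : continuous (fun x => - f x) by move=> x; apply: cvgN; exact: cf.
rewrite -lerN2 -intN; apply: ultra_Rintegral_le => //.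
rewrite (_ : (fun m : P => _) = fun m : P => - \int[m]_x f x); last exact/funext.
exact: cvgN.
Qed.
End UltraLimit.

Lemma radon_probability_compact : compact [set: P].
Proof.
rewrite compact_ultra => F UF _; have [nu Fnu] := ultra_radon_cvg UF.
by exists nu.
Qed.
End RadonSpaceCompact.

Theorem theorem1p22 (R : realType) (X : topologicalType) :
  tychonoff_space X ->
  [<-> pseudocompact_space R X;
       pseudocompact_space R (P_sigma R X);
       Cstar_embedded R (P_sigma R X);
       compact (P_sigma R X) /\
         P_sigma R X = [set: radon_probability R (stone_cech R X)]].
Proof.
move=> tX.
(* The step from (1) to (4) comes before the cycle, since the links from (2) to (3) and from (3) to
   (4) both go through it. *)
have psX_compact : pseudocompact_space R X -> compact (P_sigma R X) /\
    P_sigma R X = [set: radon_probability R (stone_cech R X)].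
  move=> psX.
  have PT : P_sigma R X = setT.
    apply/seteqP; split=> // mu _ K _ KX GK.
    by rewrite (pseudocompact_Gdelta tX psX KX GK) measure0.
  split=> //; rewrite PT.
  exact: radon_probability_compact (@stone_cech_compact R X)
    (@stone_cech_hausdorff R X).
tfae.
- by move=> /psX_compact[cP PT]; exact: P_sigmaT_pseudocompact.
- move=> /pseudocompact_P_sigma/psX_compact[_ PT].
  exact: P_sigmaT_Cstar_embedded.
- by move=> /Cstar_embedded_P_sigma/psX_compact.
- by move=> [cP PT]; apply: pseudocompact_P_sigma; exact: P_sigmaT_pseudocompact.
Qed.
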